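(* For any permuton $\mu$ and $\sigma_n\sim\mathrm{Sample}_n(\mu)$ for each $n\in\mathbb{N}^*$: $$\mathbf{P}(\sigma_n=\mathrm{id}_n)^{1/n}\xrightarrow[n\to\infty]{}\widetilde{\mathrm{LIS}}(\mu),$$ where $\mathrm{id}_n$ denotes the identity permutation of $\{1,\dots,n\}$.
   Context: $\mathbb{N}^*=\{1,2,\dots\}$. A permuton is a Borel probability measure on $[0,1]^2$ with both marginals uniform on $[0,1]$. Given points $Z_1,\dots,Z_n\in[0,1]^2$ with distinct $x$-coordinates and distinct $y$-coordinates, $\mathrm{Perm}(Z_1,\dots,Z_n)$ is the permutation $\sigma$ of $\{1,\dots,n\}$ with $\sigma(i)=j$ whenever the point with $i$-th lowest $x$-coordinate has $j$-th lowest $y$-coordinate. $\mathrm{Sample}_n(\mu)$ is the law of $\mathrm{Perm}(Z_1,\dots,Z_n)$ for $Z_1,\dots,Z_n$ i.i.d. with law $\mu$ (a.s. well defined). A subset $A\subset[0,1]^2$ is nondecreasing if $(x_2-x_1)(y_2-y_1)\ge 0$ for all $(x_1,y_1),(x_2,y_2)\in A$. $\widetilde{\mathrm{LIS}}(\mu):=\sup_A \mu(A)$ over closed nondecreasing $A\subset[0,1]^2$. *)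

(* Defs.v *)
From HB Require Import structures.
From mathcomp Require Import all_boot all_order all_algebra all_fingroup.
From mathcomp Require Import all_classical all_reals all_analysis.
From mathcomp Require Import measurable_realfun.

Set Implicit Arguments.
Unset Strict Implicit.
Unset Printing Implicit Defensive.

Import Order.TTheory GRing.Theory Num.Theory.
Import numFieldNormedType.Exports.

Local Open Scope classical_set_scope.
Local Open Scope ring_scope.

Definition unit_square (R : realType) : set (R * R) :=
  `[0, 1]%classic `*` `[0, 1]%classic.

(* A permuton is carried by R * R (with its Borel sigma-algebra) rather than
   by a subtype of it; the first conjunct says that it lives on [0, 1]^2. *)
Definition is_permuton (R : realType) (mu : probability (R * R)%type R) : Prop :=
  [/\ mu (@unit_square R) = 1%E,
      forall A : set R, measurable A ->
        pushforward mu (@fst R R) A = uniform_prob (@ltr01 R) A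
    & forall A : set R, measurable A ->
        pushforward mu (@snd R R) A = uniform_prob (@ltr01 R) A].

Definition nondecreasing_subset (R : realType) (A : set (R * R)) : Prop :=
  forall p q : R * R, A p -> A q -> 0 <= (q.1 - p.1) * (q.2 - p.2).

Definition LIS_tilde (R : realType) (mu : probability (R * R)%type R) : \bar R :=
  ereal_sup [set mu A | A in
    [set A : set (R * R) |
      [/\ A `<=` @unit_square R, closed A & nondecreasing_subset A]]].

(* 0-based: the number of entries strictly below entry k. *)
Definition rank (R : realType) (n : nat) (x : 'I_n -> R) (k : 'I_n) : nat :=
  #|[pred l | x l < x k]|.

Definition distinct_coordinates (R : realType) (n : nat)
    (Z : n.-tuple (R * R)) : bool :=
  injectiveb (fun k => (tnth Z k).1) && injectiveb (fun k => (tnth Z k).2).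

(* s i = j whenever the point with i-th lowest abscissa has j-th lowest
   ordinate. *)
Definition perm_of_points (R : realType) (n : nat) (Z : n.-tuple (R * R))
    (s : 'S_n) : bool :=
  [forall k : 'I_n, [forall i : 'I_n, [forall j : 'I_n,
     ((i == rank (fun l => (tnth Z l).1) k :> nat) &&
      (j == rank (fun l => (tnth Z l).2) k :> nat)) ==> (s i == j)]]].

(* When the coordinates are distinct there is exactly one such permutation
   (perm_of_pointsP, perm_of_points_uniq); otherwise, which has probability 0
   for i.i.d. points drawn from a permuton, the value is junk. *)
Definition Perm (R : realType) (n : nat) (Z : n.-tuple (R * R)) : 'S_n :=
  if distinct_coordinates Z then odflt 1%g [pick s | perm_of_points Z s]
  else 1%g.

Lemma rank_inj (R : realType) (n : nat) (x : 'I_n -> R) :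
  injective x -> injective (rank x).
Proof.
have lt_rank k l : x k < x l -> (rank x k < rank x l)%N.
  move=> kl; apply: proper_card; apply/properP; split.
    by apply/fintype.subsetP => i; rewrite !inE => /lt_trans; exact.
  by exists k; rewrite !inE ?ltxx.
move=> xI k l kl; apply: xI; apply/eqP; rewrite eq_le.
by rewrite !leNgt; apply/andP; split; apply/negP => /lt_rank;
  rewrite kl ltnn.
Qed.

Lemma rank_lt (R : realType) (n : nat) (x : 'I_n -> R) (k : 'I_n) :
  (rank x k < n)%N.
Proof.
rewrite -[X in (_ < X)%N]card_ord; apply: proper_card.
by apply/properP; split; [exact/fintype.subsetP | exists k; rewrite ?inE ?ltxx].
Qed.

Lemma perm_of_points_uniq (R : realType) (n : nat) (Z : n.-tuple (R * R))
    (s t : 'S_n) :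
  distinct_coordinates Z -> perm_of_points Z s -> perm_of_points Z t -> s = t.
Proof.
move=> /andP[/injectiveP xI _] sP tP.
pose f k := Ordinal (rank_lt (fun l => (tnth Z l).1) k).
have fI : injective f by move=> k l [] /(rank_inj xI).
pose g k := Ordinal (rank_lt (fun l => (tnth Z l).2) k).
have fg u k : perm_of_points Z u -> u (f k) = g k.
  by move=> /'forall_'forall_'forall_implyP/(_ k (f k) (g k))/= uP;
    apply/eqP/uP; rewrite !eqxx.
apply/permP => i; rewrite -(f_invF fI i) !fg//.
Qed.

Lemma perm_of_pointsP (R : realType) (n : nat) (Z : n.-tuple (R * R)) :
  distinct_coordinates Z -> perm_of_points Z (Perm Z).
Proof.
move=> dZ; rewrite /Perm dZ; case: pickP => [//|noP].
have /andP[/injectiveP xI /injectiveP yI] := dZ.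
pose f k := Ordinal (rank_lt (fun l => (tnth Z l).1) k).
pose g k := Ordinal (rank_lt (fun l => (tnth Z l).2) k).
have fI : injective f by move=> k l [] /(rank_inj xI).
have gI : injective g by move=> k l [] /(rank_inj yI).
suff : perm_of_points Z ((perm fI)^-1 * perm gI)%g by rewrite noP.
apply/'forall_'forall_'forall_implyP => k i j /andP[/eqP ik /eqP jk].
have -> : i = perm fI k by apply/val_inj; rewrite permE.
by rewrite permM permK permE; apply/eqP/val_inj.
Qed.

HB.instance Definition _ (T : finType) :=
  isPointed.Build (perm_type T) 1%g.

HB.instance Definition _ (T : finType) :=
  @isMeasurable.Build default_measure_display (perm_type T)
    discrete_measurable discrete_measurable0
    discrete_measurableC discrete_measurableU.

Section measurable_Perm.
Context (R : realType) (n : nat).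

Let pattern (Z : n.-tuple (R * R)) : {ffun 'I_n * 'I_n -> bool * bool} :=
  [ffun kl => ((tnth Z kl.1).1 < (tnth Z kl.2).1,
               (tnth Z kl.1).2 < (tnth Z kl.2).2)].

Let Perm_pattern (Z W : n.-tuple (R * R)) :
  pattern Z = pattern W -> Perm Z = Perm W.
Proof.
move=> /ffunP ZW.
have ltZW k l : ((tnth Z k).1 < (tnth Z l).1) = ((tnth W k).1 < (tnth W l).1) /\
                ((tnth Z k).2 < (tnth Z l).2) = ((tnth W k).2 < (tnth W l).2).
  by have := ZW (k, l); rewrite !ffunE/= => -[].
have rk1 k : rank (fun l => (tnth Z l).1) k = rank (fun l => (tnth W l).1) k.
  by apply: eq_card => l; rewrite !inE (ltZW l k).1.
have rk2 k : rank (fun l => (tnth Z l).2) k = rank (fun l => (tnth W l).2) k.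
  by apply: eq_card => l; rewrite !inE (ltZW l k).2.
have inj (f g : 'I_n -> R) : (forall k l, (f k < f l) = (g k < g l)) ->
    injectiveb f = injectiveb g.
  move=> fg; have fgE k l : (f k == f l) = (g k == g l).
    by rewrite !eq_le !leNgt !fg.
  apply/injectiveP/injectiveP => fI k l /eqP kl; apply: fI; apply/eqP.
    by rewrite fgE.
  by rewrite -fgE.
have dE : distinct_coordinates Z = distinct_coordinates W.
  by congr (_ && _); apply: inj => k l; have [] := ltZW k l.
rewrite /Perm dE; congr (if _ then odflt _ _ else _); apply: eq_pick => s.
by apply: eq_forallb => k; apply: eq_forallb => i; apply: eq_forallb => j;
  rewrite rk1 rk2.
Qed.

Let measurable_pattern (c : {ffun 'I_n * 'I_n -> bool * bool}) :
  measurable [set Z | pattern Z = c].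
Proof.
rewrite (_ : [set _ | _] = \bigcap_(kl in [set: 'I_n * 'I_n])
    ((fun Z : n.-tuple (R * R) => (tnth Z kl.1).1 < (tnth Z kl.2).1) @^-1`
       [set (c kl).1] `&`
     (fun Z : n.-tuple (R * R) => (tnth Z kl.1).2 < (tnth Z kl.2).2) @^-1`
       [set (c kl).2])); last first.
  apply/seteqP; split=> Z /=; first by move=> <- kl _; rewrite ffunE.
  by move=> cZ; apply/ffunP => kl; have [] := cZ kl Logic.I;
    rewrite ffunE/= => -> ->; case: (c kl).
have mt1 k : measurable_fun setT (fun Z : n.-tuple (R * R) => (tnth Z k).1).
  by apply: measurableT_comp => //; exact: measurable_tnth.
have mt2 k : measurable_fun setT (fun Z : n.-tuple (R * R) => (tnth Z k).2).
  by apply: measurableT_comp => //; exact: measurable_tnth.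
apply: fin_bigcap_measurable => // kl _; apply: measurableI;
  rewrite -[X in measurable X]setTI; exact: measurable_fun_ltr.
Qed.

Lemma measurable_Perm :
  measurable_fun setT (@Perm R n : n.-tuple (R * R) -> 'S_n).
Proof.
move=> _ B _; rewrite setTI.
rewrite (_ : _ @^-1` _ = \bigcup_(c in [set pattern Z | Z in @Perm R n @^-1` B])
    [set Z | pattern Z = c]); last first.
  apply/seteqP; split=> [Z BZ|Z [_ [W BW <-]] /Perm_pattern ZW].
    by exists (pattern Z) => //; exists Z.
  by rewrite /preimage/= ZW.
by apply: fin_bigcup_measurable => // c _; exact: measurable_pattern.
Qed.

HB.instance Definition _ :=
  isMeasurableFun.Build _ _ _ _ (@Perm R n) measurable_Perm.

End measurable_Perm.

Section iid_law.
Context (R : realType) (d : measure_display) (T : measurableType d)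
  (mu : probability T R).

Definition cons_pair (n : nat) (p : T * n.-tuple T) : n.+1.-tuple T :=
  [tuple of p.1 :: p.2].

Lemma measurable_cons_pair (n : nat) : measurable_fun setT (@cons_pair n).
Proof. exact: measurable_cons. Qed.

HB.instance Definition _ (n : nat) :=
  isMeasurableFun.Build _ _ _ _ (@cons_pair n) (@measurable_cons_pair n).

(* The n-fold product measure: the law of n i.i.d. points with law mu. *)
Fixpoint iid_law (n : nat) : probability (n.-tuple T) R :=
  match n with
  | 0 => \d_ [tuple]
  | n'.+1 => distribution (mu \x iid_law n')%E (@cons_pair n')
  end.

Lemma iid_lawE (n : nat) (A : 'I_n -> set T) :
  (forall i, measurable (A i)) ->
  iid_law n [set Z | forall i, A i (tnth Z i)] = (\prod_(i < n) mu (A i))%E.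
Proof.
elim: n A => [|n IHn] A mA.
  by rewrite big_ord0/= diracE mem_set// => -[].
rewrite big_ord_recl/= -IHn// /distribution /pushforward.
rewrite (_ : _ @^-1` _ =
    A ord0 `*` [set Z | forall i, A (lift ord0 i) (tnth Z i)]); last first.
  apply/seteqP; split=> [[z Z]/= AZ|[z Z]/= [Az AZ] i].
    split=> [|i]; first exact: (AZ ord0).
    by have := AZ (lift ord0 i); rewrite tnthS.
  by case: (unliftP ord0 i) => [j|] ->; rewrite ?tnthS.
rewrite product_measure1E//.
rewrite (_ : mkset _ = \bigcap_(i in [set: 'I_n])
    (fun Z => tnth Z i) @^-1` A (lift ord0 i)); last first.
  by apply/seteqP; split=> Z /= AZ i; [move=> _|]; exact: AZ.
apply: fin_bigcap_measurable => // i _; rewrite -[X in measurable X]setTI.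
exact: measurable_tnth.
Qed.

End iid_law.

Definition Sample (R : realType) (n : nat)
    (mu : probability (R * R)%type R) : probability 'S_n R :=
  distribution (iid_law mu n) (@Perm R n).

(* Main.v *)
Require Import Defs.
From HB Require Import structures.
From mathcomp Require Import all_boot all_order all_algebra all_fingroup.
From mathcomp Require Import all_classical all_reals all_analysis.
From mathcomp Require Import measurable_realfun lra.

Set Implicit Arguments.
Unset Strict Implicit.
Unset Printing Implicit Defensive.

Import Order.TTheory GRing.Theory Num.Theory.
Import numFieldNormedType.Exports.

Local Open Scope classical_set_scope.
Local Open Scope ring_scope.

(* For nondecreasing A, all n points fall in A with probability mu(A)^n, and
   they are then a.s. in increasing position: this is the lower bound.  For the
   upper bound, cut the plane into finitely many cells by the lines x = r and
   y = r for the first j rationals r.  Points in increasing position occupy a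
   chain of cells, so P(sigma_n = id) is at most N_j * c^n if every chain of
   level j has mass at most c.  Were there a chain of mass at least c at every
   level, an ultrafilter limit of these chains would be a nondecreasing set of
   mass at least c, which is excluded for c > LIS. *)

(** * Filters and roots of geometric bounds *)

Lemma filter_fin_forall (T : finType) (U : Type) (F : set_system U)
    (Q : T -> set U) :
  Filter F -> (forall c, F (Q c)) -> F [set k | forall c, Q c k].
Proof.
move=> FF FQ.
suff : F [set k | {in enum T, forall c, Q c k}].
  by apply: filterS => k /= Qk c; apply: Qk; rewrite mem_enum.
elim: (enum T) => [|c s IHs]; first exact: filterE.
apply: filterS2 (FQ c) IHs => k Qck Qsk c'.
by rewrite inE => /predU1P[->//|]; exact: Qsk.
Qed.

(** As $c/(c+e) < 1$, the product $N (c/(c+e))^n$ is eventually at most 1: the factor [N] vanishes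
    under the [n]-th root at the cost of [e]. *)
Lemma geometric_root_le (R : realType) (q : R^nat) (N c e : R) :
  0 <= c -> 0 < e ->
  (forall n, 0 <= q n <= N * c ^+ n) ->
  \forall n \near \oo, q n `^ n%:R^-1 <= c + e.
Proof.
move=> c0 e0 qN; have ce0 : 0 < c + e by rewrite ltr_wpDl.
have /cvgrPdist_lt/(_ 1 ltr01) : geometric N (c / (c + e)) @ \oo --> 0.
  apply: cvg_geometric; rewrite ger0_norm ?divr_ge0 ?(ltW ce0)//.
  by rewrite ltr_pdivrMr// mul1r ltrDl.
apply: filterS2 (nbhs_infty_gt 0) => n n0.
rewrite sub0r normrN => /(le_lt_trans (ler_norm _)); rewrite /geometric/=.
rewrite expr_div_n mulrA ltr_pdivrMr ?exprn_gt0// mul1r => /ltW Nce.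
have /andP[q0 qn] := qN n.
rewrite -[leRHS](powRr1 (ltW ce0)) -[X in _ <= _ `^ X](@mulfV _ n%:R).
  rewrite powRrM ge0_ler_powR ?invr_ge0 ?nnegrE ?powR_ge0//.
  by rewrite powR_mulrn ?(ltW ce0)// (le_trans qn).
by rewrite pnatr_eq0 -lt0n.
Qed.

(** * Grids of rational lines, their cells, and chains of cells *)

Section cells.
Context (R : realType).
Implicit Types (i j : nat) (p q : R * R) (A C : set (R * R)).

(** An index that decodes to no rational gets 0, which merely repeats a line. *)
Definition threshold i : R := ratr (odflt 0%Q (unpickle i)).

Lemma threshold_between (x y : R) : x < y -> exists i, x < threshold i < y.
Proof.
move=> /rat_in_itvoo[r]; rewrite in_itv/= => xry.
by exists (pickle r); rewrite /threshold pickleK.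
Qed.

(** This is the code of the half-open grid cell around [p]; the codes form a finite type, so any
    union of cells is a finite one. *)
Definition cell j p : {ffun 'I_j -> bool * bool} :=
  [ffun i => (threshold (val i) <= p.1, threshold (val i) <= p.2)].

Lemma cell_eqP j p q : cell j p = cell j q <->
  forall i, (i < j)%N -> ((threshold i <= p.1) = (threshold i <= q.1)) /\
                         ((threshold i <= p.2) = (threshold i <= q.2)).
Proof.
split=> [/ffunP pq i ij|pq].
  by have := pq (Ordinal ij); rewrite !ffunE => -[].
by apply/ffunP => i; rewrite !ffunE; have [-> ->] := pq i (ltn_ord i).
Qed.

Lemma cell_eq_le j k p q :
  (j <= k)%N -> cell k p = cell k q -> cell j p = cell j q.
Proof.
move=> jk /cell_eqP pq; apply/cell_eqP => i ij; apply: pq.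
exact: leq_trans jk.
Qed.

Lemma measurable_cell j (B : set {ffun 'I_j -> bool * bool}) :
  measurable (cell j @^-1` B).
Proof.
rewrite (_ : _ @^-1` _ = \bigcup_(c in B) \bigcap_(i in [set: 'I_j])
    (((fun p : R * R => threshold i <= p.1) @^-1` [set (c i).1]) `&`
     ((fun p : R * R => threshold i <= p.2) @^-1` [set (c i).2]))); last first.
  apply/seteqP; split=> [p Bp|p [c Bc cp]].
    by exists (cell j p) => // i _; rewrite ffunE.
  rewrite /preimage/= (_ : cell j p = c)//; apply/ffunP => i.
  by have [/= cp1 cp2] := cp i Logic.I; rewrite ffunE cp1 cp2; case: (c i).
apply: fin_bigcup_measurable => // c _; apply: fin_bigcap_measurable => // i _.
by apply: measurableI; rewrite -[X in measurable X]setTI;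
  apply: measurable_fun_ler.
Qed.

Definition saturation j A : set (R * R) := cell j @^-1` (cell j @` A).

(** A point outside a closed set lies in a box with rational sides that misses the set, and so does
    its cell once the level contains the four sides. This makes closed sets measurable for the
    product sigma-algebra. *)
Lemma closed_bigcap_saturation A : closed A -> A = \bigcap_j saturation j A.
Proof.
move=> cA; apply/seteqP; split=> [p Ap j _|p Ap]; first by exists p.
apply: contrapT => nAp.
have /= : open (~` A) by rewrite openC.
rewrite openE => /(_ p nAp) [/= [U V]].
move=> [/nbhs_ballP[e/= e0 eU] /nbhs_ballP[f/= f0 fV]] UVA.
have [a1 /andP[ea1 a1p]] : exists i, p.1 - e < threshold i < p.1.
  by apply: threshold_between; rewrite gtrBl.
have [b1 /andP[pb1 b1e]] : exists i, p.1 < threshold i < p.1 + e.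
  by apply: threshold_between; rewrite ltrDl.
have [a2 /andP[fa2 a2p]] : exists i, p.2 - f < threshold i < p.2.
  by apply: threshold_between; rewrite gtrBl.
have [b2 /andP[pb2 b2f]] : exists i, p.2 < threshold i < p.2 + f.
  by apply: threshold_between; rewrite ltrDl.
(* Level [j] uses only the indices below [j], hence the successor of the maximum. *)
have [q Aq /cell_eqP qp] := Ap (maxn (maxn a1 b1) (maxn a2 b2)).+1 Logic.I.
have /(_ q) := UVA; apply => //.
have /qp[a1q _] : (a1 < (maxn (maxn a1 b1) (maxn a2 b2)).+1)%N.
  by rewrite ltnS !leq_max leqnn.
have /qp[b1q _] : (b1 < (maxn (maxn a1 b1) (maxn a2 b2)).+1)%N.
  by rewrite ltnS !leq_max leqnn orbT.
have /qp[_ a2q] : (a2 < (maxn (maxn a1 b1) (maxn a2 b2)).+1)%N.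
  by rewrite ltnS !leq_max leqnn !orbT.
have /qp[_ b2q] : (b2 < (maxn (maxn a1 b1) (maxn a2 b2)).+1)%N.
  by rewrite ltnS !leq_max leqnn !orbT.
rewrite (ltW a1p) in a1q; rewrite (ltW a2p) in a2q.
rewrite !leNgt pb1 /= in b1q; move/negbFE: b1q => b1q.
rewrite !leNgt pb2 /= in b2q; move/negbFE: b2q => b2q.
split; [apply: eU|apply: fV]; rewrite -ball_normE/= ltr_norml.
  by apply/andP; split; lra.
by apply/andP; split; lra.
Qed.

Lemma measurable_saturation j A : measurable (saturation j A).
Proof. exact: measurable_cell. Qed.

Lemma measurable_closed A : closed A -> measurable A.
Proof.
move=> /closed_bigcap_saturation ->; apply: bigcap_measurableType => j _.
exact: measurable_saturation.
Qed.

Lemma nondecreasing_subsetP A : nondecreasing_subset A <->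
  (forall p q, A p -> A q -> p.1 < q.1 -> p.2 <= q.2).
Proof.
split=> [ndA p q Ap Aq pq|ndA p q Ap Aq].
  by have := ndA p q Ap Aq; rewrite pmulr_rge0 ?subr_gt0// subr_ge0.
have [pq|qp|->] := ltgtP p.1 q.1; last by rewrite subrr mul0r.
  by rewrite mulr_ge0// subr_ge0 ?(ltW pq)//; exact: ndA.
by rewrite mulr_le0// subr_le0 ?(ltW qp)//; exact: ndA.
Qed.

(** A descent, [q] being strictly to the right of [p] and strictly below it, that lines of level [j]
    detect. The strict and weak inequalities match the half-open cells, so that only the two codes
    matter. *)
Definition separated j p q := exists i i', [/\ (i < j)%N, (i' < j)%N,
  p.1 < threshold i <= q.1 & q.2 < threshold i' <= p.2].

Lemma separated_le j k p q : (j <= k)%N -> separated j p q -> separated k p q.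
Proof.
move=> jk [i [i' [ij i'j ipq i'pq]]]; exists i, i'; split => //.
  exact: leq_trans jk.
exact: leq_trans jk.
Qed.

Lemma separated_cell j p q p' q' :
  cell j p = cell j p' -> cell j q = cell j q' ->
  separated j p q -> separated j p' q'.
Proof.
move=> /cell_eqP pp' /cell_eqP qq' [i [i' [ij i'j ipq i'pq]]].
exists i, i'; move: ipq i'pq; rewrite !ltNge.
have [-> _] := pp' i ij; have [-> _] := qq' i ij.
by have [_ ->] := pp' i' i'j; have [_ ->] := qq' i' i'j.
Qed.

Definition chain j C := forall p q, C p -> C q -> ~ separated j p q.

(** Rationals inside the horizontal and vertical gaps of a descent make it detectable at some
    level. *)
Lemma nondecreasing_subset_chain A :
  (forall j, chain j A) -> nondecreasing_subset A.
Proof.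
move=> chA; apply/nondecreasing_subsetP => p q Ap Aq.
move=> /threshold_between[i /andP[pi iq]]; rewrite leNgt; apply/negP.
move=> /threshold_between[i' /andP[qi' i'p]].
apply: (chA (maxn i i').+1 p q Ap Aq); exists i, i'.
by rewrite !ltnS leq_maxl leq_maxr pi qi' !ltW.
Qed.

(** The quadrants cut out by two separating thresholds are open, so a descent between limit points
    would already occur between points of [A]. *)
Lemma closure_nondecreasing_subset A :
  nondecreasing_subset A -> nondecreasing_subset (closure A).
Proof.
move=> /nondecreasing_subsetP ndA; apply/nondecreasing_subsetP => p q clp clq.
move=> /threshold_between[i /andP[pi iq]]; rewrite leNgt; apply/negP.
move=> /threshold_between[i' /andP[qi' i'p]].
have [|u [Au [/= ui i'u]]] :=
    clp ([set x | x < threshold i] `*` [set x | threshold i' < x]).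
  exists ([set x | x < threshold i], [set x | threshold i' < x]) => //=.
  by split; apply: open_nbhs_nbhs; split.
have [|v [Av [/= iv vi']]] :=
    clq ([set x | threshold i < x] `*` [set x | x < threshold i']).
  exists ([set x | threshold i < x], [set x | x < threshold i']) => //=.
  by split; apply: open_nbhs_nbhs; split.
have := ndA u v Au Av (lt_trans ui iv).
by rewrite leNgt (lt_trans vi' i'u).
Qed.

Lemma chain_limit (mu : probability (R * R)%type R) (c : \bar R) :
  (forall j, exists2 B : set {ffun 'I_j -> bool * bool},
     chain j (cell j @^-1` B) & (c <= mu (cell j @^-1` B))%E) ->
  exists A, [/\ measurable A, nondecreasing_subset A & (c <= mu A)%E].
Proof.
move=> hB; pose B j := s2val (cid2 (hB j)).
have chB j : chain j (cell j @^-1` B j) := s2valP (cid2 (hB j)).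
have cB j : (c <= mu (cell j @^-1` B j))%E := s2valP' (cid2 (hB j)).
have [U [UU ooU]] := @ultraFilterLemma nat \oo _.
(* [Q j a] collects the [k] whose chain meets the cell [a] of level [j]; [D j] keeps the cells met
   for [U]-almost all [k]. *)
pose Q j a := [set k | (cell j @` (cell k @^-1` B k)) a].
pose D j := cell j @^-1` [set a | U (Q j a)].
have mD j : measurable (D j) by exact: measurable_cell.
have cD j : (c <= mu (D j))%E.
  (* [U] decides each of the finitely many codes of level [j], so for some [k] every cell of level
     [j] met by its chain is kept; that chain lies in [D j]. *)
  have /filter_ex[k Bk] : U [set k | forall a, Q j a k -> U (Q j a)].
    apply: filter_fin_forall => a.
    have [Ua|Ua] := in_ultra_setVsetC (Q j a) UU.
      by apply: filterE => k _.
    by apply: filterS Ua => k /= nQ /nQ.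
  apply: le_trans (cB k) _; apply: le_measure; rewrite ?inE//.
    exact: measurable_cell.
  by move=> p Bp; apply: Bk; exists p.
exists (\bigcap_j D j); split; first exact: bigcap_measurableType.
- apply: nondecreasing_subset_chain => j p q Dp Dq pq.
  (* Some chain of level [k >= j] has points in the cells of both [p] and [q]; these are separated
     at level [j], hence at level [k], against [chB]. *)
  have /filter_ex[k [[]]] : U (Q j (cell j p) `&` Q j (cell j q) `&`
      [set k | (j <= k)%N]).
    apply: filterI; first by apply: filterI; [exact: Dp|exact: Dq].
    by apply: ooU; exists j.
  move=> [p' Bp' pp'] [q' Bq' qq'] jk.
  by apply: (chB k p' q' Bp' Bq'); apply: separated_le jk _;
     apply: separated_cell pq.
(* Finer cells lie inside coarser ones, so the [D j] decrease, and continuity from above keeps the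
   mass at least [c]. *)
- have DD : {homo D : j k / (j <= k)%N >-> (k <= j)%O}.
    move=> j k jk; apply/subsetPset => p; apply: filterS => l [q Bq qp].
    by exists q => //; exact: cell_eq_le qp.
  have Dcv : mu (D j) @[j --> \oo] --> mu (\bigcap_j D j).
    apply: nonincreasing_cvg_mu => //; last exact: bigcap_measurableType.
    by rewrite (le_lt_trans (probability_le1 _ _))// ltry.
  rewrite -(cvg_lim _ Dcv)//; apply: lime_ge.
    by apply/cvg_ex; eexists; exact: Dcv.
  exact: nearW.
Qed.

End cells.

(** * Points whose permutation is the identity *)

Section Perm_identity.
Context (R : realType) (n : nat).

Lemma lt_rank (x : 'I_n -> R) k l : (rank x k < rank x l)%N = (x k < x l).
Proof.
have le_rank i j : x i <= x j -> (rank x i <= rank x j)%N.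
  move=> ij; apply: subset_leq_card; apply/fintype.subsetP => m.
  by rewrite !inE => /lt_le_trans; exact.
apply/idP/idP => [|kl].
  by apply: contraTT; rewrite -leNgt -leqNgt; exact: le_rank.
apply: proper_card; apply/properP; split; last by exists k; rewrite !inE ?ltxx.
by apply/fintype.subsetP => i; rewrite !inE => /lt_trans; exact.
Qed.

(* Unqualified, Perm is the constructor of the type of permutations. *)
Lemma Perm_eq1 (Z : n.-tuple (R * R)) : distinct_coordinates Z ->
  Defs.Perm Z = 1%g <->
  (forall k l, (tnth Z k).1 < (tnth Z l).1 -> (tnth Z k).2 < (tnth Z l).2).
Proof.
move=> dZ; have /andP[/injectiveP xI /injectiveP yI] := dZ.
split=> [PZ1 k l|xy].
  have /'forall_'forall_'forall_implyP := perm_of_pointsP dZ; rewrite PZ1 => rk.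
  have rkE m : rank (fun l => (tnth Z l).1) m = rank (fun l => (tnth Z l).2) m.
    have := rk m (Ordinal (rank_lt (fun l => (tnth Z l).1) m))
                 (Ordinal (rank_lt (fun l => (tnth Z l).2) m)).
    by rewrite !eqxx perm1 => /(_ isT)/eqP[].
  by rewrite -(lt_rank (fun l => (tnth Z l).1))
    -(lt_rank (fun l => (tnth Z l).2)) !rkE.
(* By uniqueness it is enough that the identity fits the points, that is, that the two ranks of each
   point agree. *)
apply: (perm_of_points_uniq dZ); first exact: perm_of_pointsP.
apply/'forall_'forall_'forall_implyP => k i j /andP[/eqP ik /eqP jk].
rewrite perm1 -val_eqE/= ik jk; apply/eqP/eq_card => l; rewrite !inE.
apply/idP/idP => [/xy//|]; apply: contraTT; rewrite -!leNgt.
by rewrite le_eqVlt => /predU1P[/xI ->//|/xy/ltW].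
Qed.

End Perm_identity.

(** * Coincidences among i.i.d. points *)

Section iid_distinct.
Context (R : realType) (d : measure_display) (T : measurableType d)
  (mu : probability T R).

Lemma measurable_tnth_eq (f : T -> R) n (k l : 'I_n) : measurable_fun setT f ->
  measurable [set Z : n.-tuple T | f (tnth Z k) = f (tnth Z l)].
Proof.
move=> mf; rewrite (_ : mkset _ = (fun Z : n.-tuple T =>
    f (tnth Z k) == f (tnth Z l)) @^-1` [set true]);
  last by apply/seteqP; split=> Z /= /eqP.
rewrite -[X in measurable X]setTI; apply: measurable_fun_eqr => //;
  by apply: measurableT_comp => //; exact: measurable_tnth.
Qed.

(** Induction on [n] handles coincidences within the tail. If the first point is involved, fixing it
    at [z] leaves the event that another point falls in the fibre of [f] through [z], which is
    null. *)
Lemma iid_law_eq0 (f : T -> R) n (k l : 'I_n) : measurable_fun setT f ->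
  (forall a, mu (f @^-1` [set a]) = 0%E) -> k != l ->
  iid_law mu n [set Z | f (tnth Z k) = f (tnth Z l)] = 0%E.
Proof.
move=> mf f0.
wlog kl : k l / (k < l)%N.
  move=> H; rewrite neq_ltn => /orP[] kl.
    by apply: H => //; rewrite neq_ltn kl.
  rewrite (_ : mkset _ = [set Z | f (tnth Z l) = f (tnth Z k)]); last first.
    by apply/seteqP; split=> Z /=.
  by apply: H => //; rewrite neq_ltn kl.
move=> _; elim: n k l kl => [[]//|n IHn] k l.
have mA := measurable_tnth_eq k l mf; move: mA.
case: (unliftP ord0 l) => [j ->|->]; last by rewrite ltn0.
case: (unliftP ord0 k) => [i ->|->] mA; rewrite ?lift0 ?ltnS => kl.
  rewrite /= /distribution /pushforward.
  rewrite (_ : _ @^-1` _ = setT `*`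
      [set Z | f (tnth Z i) = f (tnth Z j)]); last first.
    by apply/seteqP; split=> -[z Z] /=; rewrite !tnthS//; case.
  rewrite product_measure1E//; last exact: measurable_tnth_eq.
  by rewrite [X in (_ * X)%E](_ : _ = 0%E) ?mule0//; exact: IHn.
rewrite /= /distribution /pushforward /product_measure1.
apply: integral0_eq => z _ /=.
pose A i := if i == j then f @^-1` [set f z] else setT.
rewrite (_ : xsection _ z = [set Z | forall i, A i (tnth Z i)]); last first.
  apply/seteqP; split=> [Z|Z /(_ j)]; rewrite /xsection/= ?inE/= tnthS /A.
    by move=> /= zZ i; case: ifPn => [/eqP ->|].
  by rewrite eqxx/= => ->.
apply: etrans (iid_lawE mu _) _.
  move=> i; rewrite /A; case: ifP => // _.
  by rewrite -[X in measurable X]setTI; exact: mf.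
by rewrite (bigD1 j)//= /A eqxx f0 mul0e.
Qed.

End iid_distinct.

(** * Almost sure distinctness for a permuton *)

Section permuton.
Context (R : realType) (mu : probability (R * R)%type R).

Lemma uniform_prob_set1 (a : R) : uniform_prob (@ltr01 R) [set a] = 0%E.
Proof.
have /null_content_dominatesP := @dominates_uniform_prob R 0 1 (@ltr01 R).
by apply => //; exact: lebesgue_measure_set1.
Qed.

(** Uniform marginals have no atoms, so each of the finitely many possible coincidences is a null
    event. *)
Lemma iid_law_distinct_coordinates n : is_permuton mu ->
  (iid_law mu n).-negligible [set Z | ~~ distinct_coordinates Z].
Proof.
case=> _ mu1 mu2.
have H (f : R * R -> R) k l : f = fst \/ f = snd -> k != l ->
    (iid_law mu n).-negligible [set Z | f (tnth Z k) = f (tnth Z l)].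
  move=> ff kl; have mf : measurable_fun setT f by case: ff => ->.
  apply/negligibleP; first exact: measurable_tnth_eq.
  apply: iid_law_eq0 => // a; case: ff => ->.
    by have := mu1 [set a] (measurable_set1 _); rewrite uniform_prob_set1.
  by have := mu2 [set a] (measurable_set1 _); rewrite uniform_prob_set1.
(* The pairs are numbered through [pickle] to form a countable union; numbers coding no pair, or a
   diagonal one, contribute the empty set. *)
have dE : [set Z | ~~ distinct_coordinates Z] `<=` \bigcup_m
    (if unpickle m is Some (k, l) then if k != l :> 'I_n then
       [set Z : n.-tuple (R * R) | (tnth Z k).1 = (tnth Z l).1] `|`
       [set Z | (tnth Z k).2 = (tnth Z l).2] else set0 else set0).
  by move=> Z /=; rewrite negb_and => /orP[] /injectivePn[k [l kl eq_kl]];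
    exists (pickle (k, l)) => //; rewrite pickleK kl; [left|right].
apply: negligibleS dE _; apply: negligible_bigcup => m.
case: (unpickle m) => [[k l]|]; last exact: negligible_set0.
case: ifPn => kl; last exact: negligible_set0.
by apply: negligibleU; [apply: (H fst)|apply: (H snd)] => //; [left|right].
Qed.

End permuton.

(** * Lower and upper bounds for the probability, and the limit *)

Section bounds.
Context (R : realType).

Lemma le_measure_negligible (d : measure_display) (T : measurableType d)
    (nu : {measure set T -> \bar R}) (A B N : set T) :
  measurable A -> measurable B -> nu.-negligible N -> A `<=` B `|` N ->
  (nu A <= nu B)%E.
Proof.
move=> mA mB [M [mM M0 NM]] ABN; rewrite -(measureU0 mB mM M0).
apply: le_measure; rewrite ?inE//; first exact: measurableU.
by move=> x /ABN[?|/NM]; [left|right].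
Qed.

Lemma le_measure_bigsetU (d : measure_display) (T : measurableType d)
    (nu : {measure set T -> \bar R}) (I : Type) (s : seq I) (F : I -> set T)
    (x : R) :
  (forall i, measurable (F i)) -> (forall i, (nu (F i) <= x%:E)%E) ->
  (nu (\big[setU/set0]_(i <- s) F i) <= ((size s)%:R * x)%:E)%E.
Proof.
move=> mF Fx; elim: s => [|i s IHs]; first by rewrite big_nil measure0 mul0r.
rewrite big_cons/= -natr1 mulrDl mul1r addrC EFinD.
apply: le_trans (leeD (Fx i) IHs); apply: measureU2 => //.
by apply: bigsetU_measurable => *.
Qed.

Lemma iid_law_const (d : measure_display) (T : measurableType d)
    (mu : probability T R) (n : nat) (A : set T) : measurable A ->
  measurable [set Z : n.-tuple T | forall i, A (tnth Z i)] /\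
  iid_law mu n [set Z | forall i, A (tnth Z i)] = (fine (mu A) ^+ n)%:E.
Proof.
move=> mA; split; last first.
  apply: etrans (@iid_lawE _ _ _ mu n (fun=> A) _) _ => //.
  under eq_bigr do rewrite -[mu A]fineK ?fin_num_measure//.
  by rewrite prodEFin prodr_const card_ord.
rewrite (_ : mkset _ = \bigcap_(i in [set: 'I_n]) (fun Z => tnth Z i) @^-1` A).
  apply: fin_bigcap_measurable => // i _; rewrite -[X in measurable X]setTI.
  exact: measurable_tnth.
by apply/seteqP; split=> Z /= AZ i; [move=> _|]; exact: AZ.
Qed.

Context (mu : probability (R * R)%type R) (mu_permuton : is_permuton mu).

Lemma measurable_Perm1 n :
  measurable [set Z : n.-tuple (R * R) | Defs.Perm Z = 1%g].
Proof.
rewrite -[X in measurable X]setTI.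
exact: (@measurable_Perm R n measurableT [set 1%g]).
Qed.

Lemma nondecreasing_subset_le_Perm1 n (A : set (R * R)) :
  measurable A -> nondecreasing_subset A ->
  ((fine (mu A) ^+ n)%:E <= iid_law mu n [set Z | Defs.Perm Z = 1%g])%E.
Proof.
move=> mA ndA; have [mAn <-] := iid_law_const mu n mA.
apply: le_measure_negligible
  (iid_law_distinct_coordinates n mu_permuton) _ => //.
  exact: measurable_Perm1.
move=> Z /= AZ; have [dZ|] := boolP (distinct_coordinates Z); [left|by right].
apply/Perm_eq1 => // k l xkl.
(* Monotonicity gives a weak inequality of ordinates; distinctness makes it strict. *)
have := iffLR (nondecreasing_subsetP A) ndA _ _ (AZ k) (AZ l) xkl.
rewrite le_eqVlt => /predU1P[/= ykl|//].
have /andP[_ /injectiveP/(_ k l ykl) kl] := dZ.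
by rewrite kl ltxx in xkl.
Qed.

(** A union bound over all sets of codes: the cells occupied by points in increasing position form
    one of these sets, and it is a chain. *)
Lemma Perm1_le_chain n j (c : R) :
  (forall B : set {ffun 'I_j -> bool * bool},
     chain j (@cell R j @^-1` B) -> (mu (@cell R j @^-1` B) <= c%:E)%E) ->
  (iid_law mu n [set Z | Defs.Perm Z = 1%g] <=
    (#|{set {ffun 'I_j -> bool * bool}}|%:R * c ^+ n)%:E)%E.
Proof.
move=> Bc; have c0 : 0 <= c.
  have := Bc set0 (fun p q (p0 : set0 p) _ => False_ind _ p0).
  by rewrite preimage_set0 measure0 lee_fin.
(* Sets of codes that are not chains are replaced by the empty set, so that the bound [c] holds for
   all [S]. *)
pose C (S : {set {ffun 'I_j -> bool * bool}}) : set (R * R) :=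
  if `[< chain j (@cell R j @^-1` [set` S]) >] then
    @cell R j @^-1` [set` S] else set0.
have mC S : measurable (C S).
  by rewrite /C; case: ifP => // _; exact: measurable_cell.
have Cc S : (mu (C S) <= c%:E)%E.
  by rewrite /C; case: asboolP => [/Bc//|_]; rewrite measure0 lee_fin.
pose F S := [set Z : n.-tuple (R * R) | forall i, C S (tnth Z i)].
have FE S := iid_law_const mu n (mC S).
rewrite cardE; apply: le_trans (le_measure_bigsetU (F := F) (nu := iid_law mu n)
   (enum {: {set {ffun 'I_j -> bool * bool}}}) _ _); last 2 first.
- by move=> S; have [] := FE S.
- move=> S; have [_ FS] := FE S; rewrite [X in (X <= _)%E]FS.
  rewrite lee_fin; apply: lerXn2r; rewrite ?nnegrE ?fine_ge0//.
  by rewrite -lee_fin fineK ?fin_num_measure.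
apply: le_measure_negligible (iid_law_distinct_coordinates n mu_permuton) _.
- exact: measurable_Perm1.
- by apply: bigsetU_measurable => S _; have [] := FE S.
move=> Z PZ; have [dZ|] := boolP (distinct_coordinates Z); [left|by right].
move/(Perm_eq1 dZ) : PZ => PZ.
rewrite -bigcup_seq; exists [set cell j (tnth Z k) | k : 'I_n]%SET;
  rewrite /= ?mem_enum//.
move=> i; rewrite /C asboolT.
  by apply/imsetP; exists i.
move=> p q /imsetP[k _ pk] /imsetP[l _ ql] /(separated_cell pk ql).
move=> [a [b [_ _ /andP[ka al] /andP[lb bk]]]].
have := PZ k l (lt_le_trans ka al).
by rewrite ltNge (ltW (lt_le_trans lb bk)).
Qed.

Lemma closed_unit_square : closed (@unit_square R).
Proof.
by apply: closedI; apply: preimage_closed;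
  [move=> ? _; exact: cvg_fst | exact: interval_closed |
   move=> ? _; exact: cvg_snd | exact: interval_closed].
Qed.

(** Cutting [A] down to the square loses no mass, and taking the closure keeps it nondecreasing; so
    the limits of chains, which need not be closed, do not beat the supremum. *)
Lemma nondecreasing_subset_le_LIS (A : set (R * R)) :
  measurable A -> nondecreasing_subset A -> (mu A <= LIS_tilde mu)%E.
Proof.
move=> mA ndA; have [mu1 _ _] := mu_permuton.
have msq := measurable_closed closed_unit_square.
have mcl : measurable (closure (A `&` @unit_square R)).
  exact: measurable_closed (@closed_closure _ _).
apply: (@le_trans _ _ (mu (closure (A `&` @unit_square R)))).
  apply: (@le_measure_negligible _ _ mu _ _ (~` @unit_square R)) => //.
    apply/negligibleP; first exact: measurableC.
    by have := probability_setC mu msq; rewrite mu1 subee.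
  move=> p Ap; have [sp|sp] := pselect (@unit_square R p); [left|by right].
  exact: subset_closure.
apply: ereal_sup_ubound; exists (closure (A `&` @unit_square R)) => //; split.
- rewrite [X in _ `<=` X](iffLR (closure_id _) closed_unit_square).
  by apply: closureS; exact: subIsetr.
- exact: closed_closure.
- by apply: closure_nondecreasing_subset => p q [Ap _] [Aq _]; exact: ndA.
Qed.

Lemma chain_measure_bound (c : R) : (LIS_tilde mu < c%:E)%E ->
  exists j, forall B : set {ffun 'I_j -> bool * bool},
    chain j (@cell R j @^-1` B) -> (mu (@cell R j @^-1` B) <= c%:E)%E.
Proof.
move=> Lc; apply: contrapT => /forallNP H.
have [j|A [mA ndA cA]] := @chain_limit R mu c%:E.
  have /existsNP[B /not_implyP[chB /negP]] := H j.
  by rewrite -ltNge => /ltW cB; exists B.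
have := lt_le_trans Lc (le_trans cA (nondecreasing_subset_le_LIS mA ndA)).
by rewrite ltxx.
Qed.

Lemma iid_law_Perm1_root :
  (iid_law mu n [set Z | Defs.Perm Z = 1%g] `^ n%:R^-1)%E @[n --> \oo]
    --> LIS_tilde mu.
Proof.
have L0 : (0 <= LIS_tilde mu)%E.
  by rewrite -(measure0 mu); apply: nondecreasing_subset_le_LIS.
have L1 : (LIS_tilde mu <= 1)%E.
  apply: ge_ereal_sup => _ [A [_ cA _] <-]; apply: probability_le1.
  exact: measurable_closed.
have Lfin : LIS_tilde mu \is a fin_num.
  by rewrite ge0_fin_numE// (le_lt_trans L1)// ltry.
pose q n := fine (iid_law mu n [set Z | Defs.Perm Z = 1%g]).
have qE n : iid_law mu n [set Z | Defs.Perm Z = 1%g] = (q n)%:E.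
  by rewrite fineK// fin_num_measure//; exact: measurable_Perm1.
rewrite -(fineK Lfin); under eq_fun do rewrite qE poweR_EFin.
apply: cvg_EFin; first exact: nearW.
apply/cvgrPdist_le => e e0.
(* Half of [e] goes to the chain mass, the other half to the loss in [geometric_root_le]. *)
have [|j Bc] := @chain_measure_bound (fine (LIS_tilde mu) + e / 2).
  by rewrite -[ltLHS](fineK Lfin) lte_fin ltrDl divr_gt0.
have Hq n : 0 <= q n <= #|{set {ffun 'I_j -> bool * bool}}|%:R *
    (fine (LIS_tilde mu) + e / 2) ^+ n.
  by rewrite fine_ge0//= -lee_fin -qE; exact: Perm1_le_chain Bc.
have := geometric_root_le _ _ Hq.
move=> /(_ (e / 2)); rewrite divr_gt0//.
rewrite addr_ge0 ?fine_ge0 ?divr_ge0 ?(ltW e0)//.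
move=> /(_ isT isT); apply: filterS2 (nbhs_infty_gt 0) => n n0 qle.
rewrite ler_distlC; apply/andP; split; last first.
  by apply: le_trans qle _; rewrite -addrA -splitr.
(* The lower bound holds at every [n > 0]: each admissible [A] has mass at most the [n]-th root of
   [q n], hence so does the supremum. *)
apply: (@le_trans _ _ (fine (LIS_tilde mu))).
  by rewrite lerBlDr lerDl ltW.
rewrite -lee_fin (fineK Lfin); apply: ge_ereal_sup => _ [A [_ cA ndA] <-].
have mA := measurable_closed cA; have Afin := fin_num_measure mu A mA.
have := nondecreasing_subset_le_Perm1 n mA ndA.
rewrite qE lee_fin => Aq; rewrite -[leLHS](fineK Afin) lee_fin.
have n1 : n%:R != 0 :> R by rewrite pnatr_eq0 -lt0n.
rewrite /= -[leLHS]powRr1 ?fine_ge0// -[X in _ `^ X <= _](mulfV n1).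
rewrite powRrM powR_mulrn ?fine_ge0//.
by apply: ge0_ler_powR; rewrite ?nnegrE ?invr_ge0 ?exprn_ge0 ?fine_ge0.
Qed.

End bounds.

Theorem corollary2p5 (R : realType) (mu : probability (R * R)%type R)
    (mu_permuton : is_permuton mu)
    (d : nat -> measure_display) (Omega : forall n : nat, measurableType (d n))
    (P : forall n : nat, probability (Omega n) R)
    (sigma : forall n : nat, {RV (P n) >-> 'S_n})
    (sigma_law : forall n : nat, (0 < n)%N -> forall A : set 'S_n,
       distribution (P n) (sigma n) A = Sample n mu A) :
  (P n [set w | sigma n w = 1%g] `^ (n%:R)^-1)%E @[n --> \oo]
    --> LIS_tilde mu.
Proof.
apply: cvg_trans (iid_law_Perm1_root mu_permuton).
(* The laws are prescribed for [n > 0] only, so the two sequences are identified eventually. *)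
apply: near_eq_cvg; apply: filterS (nbhs_infty_gt 0) => n n0.
congr (_ `^ _)%E.
exact: esym (sigma_law n n0 [set 1%g]).
Qed.
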